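(* Let $N\ge 1$, $p\in[0,1]^N$, and let $\zeta\in\{0,1\}^N$ have independent Bernoulli entries with $\mathbb P(\zeta_i=1)=p_i$; let $Z=\sum_{i=1}^N\zeta_i$. Let $\mathcal Z=\{z_1,\dots,z_m\}\subseteq\{0,1,\dots,N\}$ with $\mathbb P(Z\in\mathcal Z)>0$, and let $f:\{0,1\}^N\to\mathbb R$. Write $\mathbb P(z)=\mathbb P(Z=z)$, $\mathbb E[\,\cdot\mid z]=\mathbb E[\,\cdot\mid Z=z]$. Then $$\mathbb P(\zeta\mid Z\in\mathcal Z)=\frac{1}{\sum_{z\in\mathcal Z}\mathbb P(z)}\sum_{z\in\mathcal Z}\mathbb P(\zeta\mid Z=z)\,\mathbb P(z),$$ $$\mathbb E[f(\zeta)\mid Z\in\mathcal Z]=\frac{1}{\sum_{z\in\mathcal Z}\mathbb P(z)}\sum_{z\in\mathcal Z}\mathbb E[f(\zeta)\mid z]\,\mathbb P(z),$$ $$\mathrm{var}(f(\zeta)\mid Z\in\mathcal Z)=\frac{\sum_{z\in\mathcal Z}\mathbb E[f(\zeta)^2\mid z]\,\mathbb P(z)}{\sum_{z\in\mathcal Z}\mathbb P(z)}-\frac{\sum_{i=1}^m\sum_{j=1}^m\mathbb E[f(\zeta)\mid z_i]\,\mathbb E[f(\zeta)\mid z_j]\,\mathbb P(z_i)\,\mathbb P(z_j)}{\bigl(\sum_{z\in\mathcal Z}\mathbb P(z)\bigr)^2}.$$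
   Context: The elements $z_1,\dots,z_m$ are distinct. Here $\mathbb P(Z=z)$ is the Poisson binomial probability mass function and $\mathbb P(\zeta\mid Z=z)$ is the conditional Bernoulli probability mass function (the law of $\zeta$ conditioned on $Z=z$, which vanishes at any $\zeta$ with $\sum_i\zeta_i\ne z$). Explicitly, with $S=\{1,\dots,N\}$, $O=\{i:p_i=0\}$, $I=\{i:p_i=1\}$, $V=S\setminus(I\cup O)$, $w_j=\frac{p_j}{1-p_j}$ for $j\in V$, and $R(k,A)=\sum_{B\subseteq A,|B|=k}\prod_{i\in B}w_i$ (with $R(0,A)=1$ and $R(k,A)=0$ for $k<0$ or $k>|A|$): $\mathbb P(Z=z)=R(z-|I|,V)\prod_{j\in V}(1-p_j)$, and $\mathbb P(\zeta\mid Z=z)=\prod_{j\in V}w_j^{\zeta_j}/R(z-|I|,V)$ if $\zeta_j=p_j$ for all $j\in I\cup O$ and $\sum_{j\in V}\zeta_j=z-|I|$, and $0$ otherwise. A term containing a factor $\mathbb P(z)=0$ is read as $0$. The law $\mathbb P(\zeta\mid Z\in\mathcal Z)$ is called the generalized conditional Bernoulli model. *)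

(* Defs.v *)
From HB Require Import structures.
From mathcomp Require Import all_boot all_order all_algebra.
From mathcomp Require Import all_classical all_reals all_analysis.
Set Implicit Arguments.
Unset Strict Implicit.
Unset Printing Implicit Defensive.
Import Order.TTheory GRing.Theory Num.Theory.

Local Open Scope classical_set_scope.
Local Open Scope ring_scope.

(* The law P( . | A).  By the convention of [mnormalize] it is P itself when
   P A = 0. *)
Definition cond_prob d (T : measurableType d) (R : realType)
    (P : probability T R) (A : set T) (mA : measurable A) : probability T R :=
  mnormalize (mrestr P mA) P.

Definition mutually_independent d d' (T : measurableType d)
    (T' : measurableType d') (R : realType) (P : probability T R)
    (I : finType) (X : I -> {RV P >-> T'}) : Prop :=
  forall (J : {set I}) (B : I -> set T'),
    (forall i, i \in J -> measurable (B i)) ->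
    P (\bigcap_(i in [set` J]) (X i @^-1` B i)) =
    (\prod_(i in J) P (X i @^-1` B i))%E.

Section bernoulli_vector.
Context d (T : measurableType d) (R : realType) (P : probability T R).
Context (N : nat) (zeta : 'I_N -> {RV P >-> bool}).

Definition bvec (w : T) : {ffun 'I_N -> bool} := [ffun i => zeta i w].

Definition bsum (w : T) : nat := (\sum_(i < N) zeta i w)%N.

Definition bsum_in (Zs : {set 'I_N.+1}) : set T :=
  [set w | exists2 k : 'I_N.+1, k \in Zs & bsum w = k].

Lemma measurable_bvec (B : set {ffun 'I_N -> bool}) :
  measurable (bvec @^-1` B).
Proof.
have -> : bvec @^-1` B =
    \bigcup_(x in B) \bigcap_(i in [set: 'I_N]) (zeta i @^-1` [set x i]).
  apply/seteqP; split => w /=.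
    by move=> Bw; exists (bvec w) => // i _ /=; rewrite ffunE.
  case=> x Bx xw; suff -> : bvec w = x by [].
  by apply/ffunP => i; rewrite ffunE; exact: xw.
apply: fin_bigcup_measurable; first exact: finite_finset.
move=> x _; apply: fin_bigcap_measurable; first exact: finite_finset.
by move=> i _; rewrite -[X in measurable X]setTI; exact: measurable_funP.
Qed.

Lemma measurable_bsum_in (Zs : {set 'I_N.+1}) : measurable (bsum_in Zs).
Proof.
have -> : bsum_in Zs = bvec @^-1`
    [set x : {ffun 'I_N -> bool} | exists2 k : 'I_N.+1, k \in Zs & (\sum_(i < N) x i)%N = k].
  apply/seteqP; split => w [k kZ wk]; exists k => //; rewrite -wk /bsum;
    by apply: eq_bigr => i _; rewrite ffunE.
exact: measurable_bvec.
Qed.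

(* The law P( . | Z \in Zs), where Z = \sum_i zeta_i. *)
Definition gen_cond_bernoulli (Zs : {set 'I_N.+1}) : probability T R :=
  cond_prob P (measurable_bsum_in Zs).

End bernoulli_vector.

Section conditional_bernoulli.
Context (R : realType) (N : nat) (p : 'I_N -> R).

Definition idxO : {set 'I_N} := [set i | p i == 0].
Definition idxI : {set 'I_N} := [set i | p i == 1].
Definition idxV : {set 'I_N} := [set: 'I_N]%SET :\: (idxI :|: idxO).

Definition odds (j : 'I_N) : R := p j / (1 - p j).

(* R(k, A): integer k, so that the sum is empty for k < 0 and for k > #|A|. *)
Definition cbR (k : int) (A : {set 'I_N}) : R :=
  \sum_(B : {set 'I_N} | (B \subset A) && (#|B|%:Z == k))
    \prod_(i in B) odds i.

(* P(Z = z) *)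
Definition poisson_binomial_pmf (z : nat) : R :=
  cbR (z%:Z - #|idxI|%:Z) idxV * \prod_(j in idxV) (1 - p j).

(* P(zeta = x | Z = z); since _ / 0 = 0 it vanishes identically when
   P(Z = z) = 0. *)
Definition cond_bernoulli_pmf (z : nat) (x : {ffun 'I_N -> bool}) : R :=
  if [forall j in idxI :|: idxO, (x j)%:R == p j]
     && ((\sum_(j in idxV) x j)%N%:Z == z%:Z - #|idxI|%:Z)
  then (\prod_(j in idxV) odds j ^+ x j) / cbR (z%:Z - #|idxI|%:Z) idxV
  else 0.

(* E[g(zeta) | Z = z] *)
Definition cond_bernoulli_exp (z : nat) (g : {ffun 'I_N -> bool} -> R) : R :=
  \sum_(x : {ffun 'I_N -> bool}) g x * cond_bernoulli_pmf z x.

End conditional_bernoulli.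

(* Main.v *)
Require Import Defs.
From mathcomp Require Import all_boot all_order all_algebra.
From mathcomp Require Import all_classical all_reals all_analysis.
From mathcomp Require Import ring.
Set Implicit Arguments.
Unset Strict Implicit.
Unset Printing Implicit Defensive.
Import Order.TTheory GRing.Theory Num.Theory.
Local Open Scope classical_set_scope.
Local Open Scope ring_scope.

(* By independence [zeta] is a finite-valued variable whose mass function is the
   product Bernoulli weight.  For each [k] the product of [cond_bernoulli_pmf]
   and [poisson_binomial_pmf] is that weight restricted to configurations of sum
   [k]: the normalizing constant [cbR] cancels, and where it vanishes so does the
   weight.  Summing over [k] in [Zs] gives the joint law of [zeta] on
   [bsum_in zeta Zs], and all three formulas are finite sums against it. *)

(** * Finite-valued variables: expectation, variance, conditioning *)

(** [g \o h] is a finite linear combination of indicators of fibres of [h], so linearity of the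
    integral suffices. As [F] carries no measurable structure, measurability is required fibre by
    fibre. *)
Lemma expectation_fin_comp (d : measure_display) (T : measurableType d)
    (R : realType) (Q : probability T R) (F : finType) (h : T -> F) (g : F -> R)
    (mh : forall x, measurable (h @^-1` [set x])) :
  'E_Q[g \o h]%E = (\sum_x g x * fine (Q (h @^-1` [set x])))%:E.
Proof.
rewrite unlock.
have -> : (fun w => ((g \o h) w)%:E) =
    (fun w => (\sum_x ((g x)%:E * (\1_(h @^-1` [set x]) w)%:E))%E).
  apply/funext => w /=; under eq_bigr do rewrite -EFinM.
  rewrite sumEFin; congr (_%:E).
  rewrite (bigD1 (h w)) //= big1 => [|x xh]; rewrite indicE.
    by rewrite mem_set // mulr1 addr0.
  by rewrite memNset ?mulr0 //= => hx; rewrite hx eqxx in xh.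
rewrite integral_sum //; last first.
  by move=> x; apply: integrableZl => //; exact: integrable_indic.
rewrite -sumEFin; apply: eq_bigr => x _.
rewrite integralZl //; last exact: integrable_indic.
rewrite integral_indic // setIT EFinM fineK // fin_num_measure //.
Qed.

Lemma variance_fin_comp (d : measure_display) (T : measurableType d)
    (R : realType) (Q : probability T R) (F : finType) (h : T -> F) (g : F -> R)
    (mh : forall x, measurable (h @^-1` [set x])) :
  'V_Q[g \o h]%E =
  ('E_Q[(fun x => (g x ^+ 2)%R) \o h] - 'E_Q[g \o h] ^+ 2)%E.
Proof.
(* Total mass one, read off from the expectation of the constant 1. *)
have q1 : \sum_x fine (Q (h @^-1` [set x])) = 1.
  apply: EFin_inj; rewrite -(expectation_cst Q 1).
  rewrite (expectation_fin_comp Q (fun=> 1) mh).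
  by congr (_%:E); apply: eq_bigr => x _; rewrite mul1r.
rewrite /variance unlock.
set c := fine 'E_Q[g \o h]%E.
rewrite (_ : _ * _ = (fun x => (g x - c) ^+ 2) \o h); last first.
  by apply/funext => w /=; rewrite expr2.
have Ec : 'E_Q[g \o h]%E = c%:E by rewrite /c expectation_fin_comp.
rewrite Ec !expectation_fin_comp // -EFin_expe -EFinB; congr (_%:E).
have cE : c = \sum_x g x * fine (Q (h @^-1` [set x])).
  by rewrite /c expectation_fin_comp.
transitivity (\sum_x (g x ^+ 2 * fine (Q (h @^-1` [set x])) -
    2 * c * (g x * fine (Q (h @^-1` [set x]))) +
    c ^+ 2 * fine (Q (h @^-1` [set x])))).
  by apply: eq_bigr => x _; ring.
rewrite big_split sumrB -!big_distrr /= q1 -cE; ring.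
Qed.

Lemma cond_probE (d : measure_display) (T : measurableType d) (R : realType)
    (P : probability T R) (A : set T) (mA : measurable A) (B : set T) :
  (0 < P A)%E -> measurable B ->
  cond_prob P mA B = (fine (P (B `&` A)) / fine (P A))%:E.
Proof.
move=> PA0 mB; rewrite /cond_prob /= /mnormalize /= /mrestr /= setTI.
(* Mass zero and infinite mass are the cases where [mnormalize] falls back on its default; both are
   excluded. *)
rewrite gt_eqF //= lt_eqF ?ltey_eq ?fin_num_measure //=.
rewrite EFinM fineK // fin_num_measure //; exact: measurableI.
Qed.

(** * Finite-sum identities for the product Bernoulli weight *)

Section conditional_bernoulli.
Variables (R : realType) (N : nat) (p : 'I_N -> R).
Hypothesis p01 : forall i, 0 <= p i <= 1.
Implicit Type x : {ffun 'I_N -> bool}.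

Definition bernoulli_pmf x : R := \prod_i (if x i then p i else 1 - p i).

Let V := idxV p.
(** Spelled as the test in [cond_bernoulli_pmf], which can then be folded into it. *)
Let agrees x := [forall j in idxI p :|: idxO p, (x j)%:R == p j].

Lemma in_idxV j : (j \in V) = (p j != 1) && (p j != 0).
Proof. by rewrite !inE andbT negb_or. Qed.

Lemma agreesP x :
  reflect (forall j, j \notin V -> (x j)%:R = p j) (agrees x).
Proof.
apply: (iffP forall_inP) => xp j.
  by move=> jV; apply/eqP/xp; rewrite !inE; rewrite !inE andbT negbK in jV.
by move=> jIO; apply/eqP/xp; rewrite inE jIO.
Qed.

Lemma odds_gt0 j : j \in V -> 0 < odds p j.
Proof.
rewrite in_idxV => /andP[p1 p0]; have /andP[? ?] := p01 j.
by rewrite divr_gt0 ?subr_gt0 ?lt_neqAle ?p1 // eq_sym p0.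
Qed.

(** Factors off [V] equal 1; on [V], [p j] is [odds p j * (1 - p j)]. *)
Lemma bernoulli_pmf_agrees x : agrees x ->
  bernoulli_pmf x = (\prod_(j in V) odds p j ^+ x j) * \prod_(j in V) (1 - p j).
Proof.
move=> /agreesP xp; rewrite -big_split /= /bernoulli_pmf.
rewrite (bigID (mem V)) /= [X in _ * X]big1 ?mulr1 => [|j /xp <-]; last first.
  by case: (x j) => //=; rewrite subr0.
apply: eq_bigr => j; rewrite in_idxV => /andP[p1 _].
case: (x j); rewrite ?expr0 ?mul1r ?expr1 //.
by rewrite /odds divfK // subr_eq0 eq_sym.
Qed.

Lemma bernoulli_pmf_disagrees x : ~~ agrees x -> bernoulli_pmf x = 0.
Proof.
move=> xp; apply/eqP; apply: contraNT xp => /prodf_neq0 qx.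
apply/agreesP => j; rewrite in_idxV -negb_or negbK.
by move: (qx j isT); case: (x j) => q0 /orP[]/eqP pj;
  rewrite pj ?subrr ?eqxx in q0 *.
Qed.

(** The entries off [V] are 1 on [idxI p] and 0 on [idxO p], hence add up to [#|idxI p|].
    Subtraction in the integers keeps this valid for [k] below that number. *)
Lemma sum_agrees x (k : nat) : agrees x ->
  ((\sum_(j in V) x j)%N%:Z == k%:Z - #|idxI p|%:Z) = ((\sum_j x j)%N == k).
Proof.
move=> /agreesP xp; rewrite [X in _ = (X == _)](bigID (mem V)) /=.
suff -> : (\sum_(j | j \notin V) x j = #|idxI p|)%N.
  by rewrite eq_sym subr_eq -PoszD eqz_nat eq_sym.
rewrite -sum1_card [LHS]big_mkcond [RHS]big_mkcond /=; apply: eq_bigr => j _.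
case: ifPn => [jV|]; last first.
  by rewrite negbK in_idxV inE => /andP[/negbTE->].
have := xp j jV; rewrite inE; case: (x j) => /= <-; rewrite ?eqxx //.
by rewrite eq_sym oner_eq0.
Qed.

(* Configurations that agree with the deterministic entries correspond to the
   subsets of V. *)
Lemma cbR_sum_ffun (k : int) :
  cbR p k V = \sum_(x | agrees x && ((\sum_(j in V) x j)%N%:Z == k))
    \prod_(j in V) odds p j ^+ x j.
Proof.
(* [h] completes a subset by the forced values off [V]; [h'] recovers the subset. *)
pose h (B : {set 'I_N}) := [ffun j => if j \in V then j \in B else p j == 1].
pose h' x : {set 'I_N} := [set j in V | x j].
rewrite [RHS](reindex_onto h h') /=; last first.
  move=> x /andP[/agreesP xp _]; apply/ffunP => j; rewrite ffunE.
  case: ifPn => [jV|/xp <-]; first by rewrite inE jV.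
  by case: (x j); rewrite ?eqxx // eq_sym oner_eq0.
have hV B j : j \in V -> h B j = (j \in B) by move=> jV; rewrite ffunE jV.
(* [h' (h B)] is the part of [B] inside [V], so the side condition left by the reindexing is exactly
   the constraint in [cbR]. *)
have hh' B : (h' (h B) == B) = (B \subset V).
  apply/eqP/idP => [<-|BV].
    by apply/fintype.subsetP => j; rewrite inE => /andP[].
  apply/setP => j; rewrite inE ffunE.
  case: ifPn => //= jV; apply/esym/negbTE; apply: contraNN jV.
  exact/fintype.subsetP.
have agh B : agrees (h B).
  apply/agreesP => j jV; rewrite ffunE (negbTE jV).
  by move: jV; rewrite in_idxV -negb_or negbK => /orP[]/eqP->;
    rewrite ?eqxx // eq_sym oner_eq0.
rewrite /cbR; apply: eq_big => [B|B /andP[BV _]].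
  rewrite hh' agh /= andbC.
  case: (boolP (B \subset V)) => BV; rewrite ?andbF // !andbT.
  congr (_%:Z == _); rewrite -sum1_card big_mkcond [RHS]big_mkcond /=.
  apply: eq_bigr => j _; case: ifPn => jB; last first.
    by case: ifP => // /hV ->; rewrite (negbTE jB).
  by have jV := fintype.subsetP BV _ jB; rewrite jV hV // jB.
rewrite big_mkcond [RHS]big_mkcond /=.
apply: eq_bigr => j _; case: ifPn => jB; last first.
  by case: ifP => // /hV ->; rewrite (negbTE jB).
by have jV := fintype.subsetP BV _ jB; rewrite jV hV // jB.
Qed.

(** All odds on [V] are positive, so a single admissible configuration makes the sum positive. *)
Lemma cbR_neq0 x (k : int) : agrees x ->
  (\sum_(j in V) x j)%N%:Z == k -> cbR p k V != 0.
Proof.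
move=> xp xk; rewrite cbR_sum_ffun gt_eqF //.
have pos (y : {ffun 'I_N -> bool}) : 0 < \prod_(j in V) odds p j ^+ y j.
  by apply: prodr_gt0 => j /odds_gt0 /exprn_gt0.
rewrite (bigD1 x) ?xp //= ltr_wpDr // sumr_ge0 // => y _; exact: ltW.
Qed.

(** This realizes the convention that a term with zero mass at [k] is 0: if [cbR] vanishes, no
    agreeing configuration has sum [k], and both sides are 0. *)
Lemma cond_bernoulli_pmfM (k : nat) x :
  cond_bernoulli_pmf p k x * poisson_binomial_pmf p k =
  if (\sum_j x j)%N == k then bernoulli_pmf x else 0.
Proof.
rewrite /cond_bernoulli_pmf /poisson_binomial_pmf -/V -/(agrees x).
have [xp|xp] /= := boolP (agrees x); last first.
  by rewrite mul0r bernoulli_pmf_disagrees // if_same.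
rewrite sum_agrees //; case: ifPn => [xk|]; last by rewrite mul0r.
rewrite mulrA divfK ?bernoulli_pmf_agrees //.
by apply: (cbR_neq0 xp); rewrite sum_agrees.
Qed.

Lemma poisson_binomial_pmfE (k : nat) :
  poisson_binomial_pmf p k =
  \sum_(x : {ffun 'I_N -> bool} | (\sum_j x j)%N == k) bernoulli_pmf x.
Proof.
rewrite /poisson_binomial_pmf -/V cbR_sum_ffun big_distrl /=.
rewrite [RHS](bigID agrees) /= [X in _ = _ + X]big1 ?addr0; last first.
  by move=> x /andP[_ /bernoulli_pmf_disagrees].
apply: eq_big => [x|x /andP[xp _]]; last by rewrite bernoulli_pmf_agrees.
rewrite andbC; case: (boolP (agrees x)) => xp; rewrite ?andbF // !andbT.
exact: sum_agrees.
Qed.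

(** Boolean counterpart of [bsum_in] on configurations, usable as a filter in finite sums. *)
Definition sum_in (Zs : {set 'I_N.+1}) x : bool :=
  [exists k in Zs, (\sum_j x j)%N == k].

(** At most one [k] in [Zs] equals the sum of [x], so [c] is never counted twice. *)
Lemma sum_in_sum (Zs : {set 'I_N.+1}) x (c : R) :
  \sum_(k in Zs) (if (\sum_j x j)%N == k then c else 0) =
  if sum_in Zs x then c else 0.
Proof.
rewrite -big_mkcondr /=; case: ifPn => [/exists_inP[k kZ /eqP xk]|xZ].
  rewrite (bigD1 k) /= ?kZ ?xk //= big1 ?addr0 // => i /andP[/andP[_ /eqP ki]].
  by case/eqP; apply/val_inj.
rewrite big1 // => k /andP[kZ xk]; by case/exists_inP: xZ; exists k.
Qed.

Lemma sum_poisson_binomial_pmf (Zs : {set 'I_N.+1}) :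
  \sum_(k in Zs) poisson_binomial_pmf p k =
  \sum_(x | sum_in Zs x) bernoulli_pmf x.
Proof.
under eq_bigr do rewrite poisson_binomial_pmfE big_mkcond.
rewrite exchange_big [RHS]big_mkcond /=.
by apply: eq_bigr => x _; rewrite sum_in_sum.
Qed.

Lemma sum_cond_bernoulli_pmfM (Zs : {set 'I_N.+1}) x :
  \sum_(k in Zs) cond_bernoulli_pmf p k x * poisson_binomial_pmf p k =
  if sum_in Zs x then bernoulli_pmf x else 0.
Proof. by under eq_bigr do rewrite cond_bernoulli_pmfM; rewrite sum_in_sum. Qed.

Lemma sum_cond_bernoulli_expM (Zs : {set 'I_N.+1}) g :
  \sum_(k in Zs) cond_bernoulli_exp p k g * poisson_binomial_pmf p k =
  \sum_x g x * \sum_(k in Zs)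
    cond_bernoulli_pmf p k x * poisson_binomial_pmf p k.
Proof.
under eq_bigr do rewrite big_distrl; rewrite exchange_big /=.
apply: eq_bigr => x _; rewrite big_distrr /=.
by apply: eq_bigr => k _; rewrite mulrA.
Qed.

End conditional_bernoulli.

(** * Transfer to the law of [zeta] *)

Section generalized_conditional_bernoulli.
Variables (R : realType) (d : measure_display) (T : measurableType d).
Variables (P : probability T R) (N : nat) (p : 'I_N -> R).
Variable zeta : 'I_N -> {RV P >-> bool}.
Hypothesis p01 : forall i, 0 <= p i <= 1.
Hypothesis zeta_indep : mutually_independent zeta.
Hypothesis zeta_law : forall i, P (zeta i @^-1` [set true]) = (p i)%:E.

(** The one point where independence and the marginal laws are invoked directly: a fibre of
    [bvec zeta] is an intersection of events on single coordinates. *)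
Lemma bvec_law x : P (bvec zeta @^-1` [set x]) = (bernoulli_pmf p x)%:E.
Proof.
have -> : bvec zeta @^-1` [set x] =
    \bigcap_(i in [set` [set: 'I_N]%SET]) (zeta i @^-1` [set x i]).
  apply/seteqP; split => w /= xw; first by move=> i _; rewrite -xw ffunE.
  by apply/ffunP => i; rewrite ffunE; apply: xw; rewrite /= inE.
rewrite zeta_indep // -prodEFin; apply: eq_big => [i|i _]; first by rewrite inE.
case: (x i) => //.
(* The fibre over [false] is the complement of the one over [true], of mass [1 - p i]. *)
rewrite (_ : _ @^-1` _ = ~` (zeta i @^-1` [set true])).
  rewrite probability_setC ?zeta_law //.
  by rewrite -[X in measurable X]setTI; exact: measurable_funP.
by apply/seteqP; split => w /=; case: (zeta i w).
Qed.

Lemma bsum_in_bvec Zs w : bsum_in zeta Zs w <-> sum_in Zs (bvec zeta w).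
Proof.
have sE : (\sum_j bvec zeta w j)%N = bsum zeta w.
  by apply: eq_bigr => j _; rewrite ffunE.
split=> [[k kZ wk]|/exists_inP[k kZ /eqP wk]].
  by apply/exists_inP; exists k; rewrite ?sE ?wk.
by exists k; rewrite // -wk sE.
Qed.

Lemma bsum_in_law Zs :
  P (bsum_in zeta Zs) = (\sum_(k in Zs) poisson_binomial_pmf p k)%:E.
Proof.
have mb x : measurable (bvec zeta @^-1` [set x]) := measurable_bvec zeta _.
have := expectation_fin_comp P (fun x => (sum_in Zs x)%:R) mb.
(* The indicator of the event factors through [bvec zeta], so its expectation is a finite sum. *)
rewrite (_ : _ \o _ = \1_(bsum_in zeta Zs)); last first.
  apply/funext => w; rewrite indicE /=; congr (_%:R); congr nat_of_bool.
  by apply/idP/idP; rewrite inE; move/bsum_in_bvec.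
rewrite expectation_indic //; last exact: measurable_bsum_in.
move=> ->; congr (_%:E); rewrite sum_poisson_binomial_pmf // [RHS]big_mkcond /=.
apply: eq_bigr => x _; rewrite bvec_law /=.
by case: ifP => _; rewrite ?mul1r ?mul0r.
Qed.

Lemma gen_cond_bernoulliE Zs x : (0 < P (bsum_in zeta Zs))%E ->
  gen_cond_bernoulli zeta Zs (bvec zeta @^-1` [set x]) =
  ((\sum_(k in Zs) poisson_binomial_pmf p k)^-1 *
   \sum_(k in Zs) cond_bernoulli_pmf p k x * poisson_binomial_pmf p k)%:E.
Proof.
move=> Z0; rewrite /gen_cond_bernoulli cond_probE //; last exact: measurable_bvec.
rewrite bsum_in_law /= mulrC sum_cond_bernoulli_pmfM //.
(* The fibre over [x] lies inside the conditioning event or misses it. *)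
congr ((_ * _)%:E); case: ifPn => xZ.
  rewrite (_ : _ `&` _ = bvec zeta @^-1` [set x]) ?bvec_law //.
  apply/seteqP; split => [w []//|w /= wx].
  by split => //; apply/bsum_in_bvec; rewrite wx.
rewrite (_ : _ `&` _ = set0) ?measure0 //.
by apply/seteqP; split => // w [/= wx /bsum_in_bvec]; rewrite wx (negbTE xZ).
Qed.

Lemma gen_cond_bernoulli_exp Zs g : (0 < P (bsum_in zeta Zs))%E ->
  'E_(gen_cond_bernoulli zeta Zs)[g \o bvec zeta]%E =
  ((\sum_(k in Zs) poisson_binomial_pmf p k)^-1 *
   \sum_(k in Zs) cond_bernoulli_exp p k g * poisson_binomial_pmf p k)%:E.
Proof.
move=> Z0; rewrite expectation_fin_comp; last by move=> x; exact: measurable_bvec.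
congr (_%:E); rewrite sum_cond_bernoulli_expM big_distrr /=.
by apply: eq_bigr => x _; rewrite gen_cond_bernoulliE //= mulrCA.
Qed.

End generalized_conditional_bernoulli.

Theorem theorem3p3 (R : realType) (d : measure_display) (T : measurableType d)
    (P : probability T R) (N : nat) (p : 'I_N -> R)
    (zeta : 'I_N -> {RV P >-> bool})
    (m : nat) (z : 'I_m -> 'I_N.+1) (Zs : {set 'I_N.+1})
    (f : {ffun 'I_N -> bool} -> R)
    (hN : (1 <= N)%N)
    (hp : forall i, 0 <= p i <= 1)
    (hindep : mutually_independent zeta)
    (hlaw : forall i, P (zeta i @^-1` [set true]) = (p i)%:E)
    (hz : injective z)
    (hZs : Zs = [set z i | i : 'I_m]%SET)
    (hpos : (0 < P (bsum_in zeta Zs))%E) :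
  [/\ forall x : {ffun 'I_N -> bool},
        gen_cond_bernoulli zeta Zs (bvec zeta @^-1` [set x]) =
        ((\sum_(k in Zs) poisson_binomial_pmf p k)^-1 *
         \sum_(k in Zs)
           cond_bernoulli_pmf p k x * poisson_binomial_pmf p k)%:E,
      'E_(gen_cond_bernoulli zeta Zs)[f \o bvec zeta]%E =
        ((\sum_(k in Zs) poisson_binomial_pmf p k)^-1 *
         \sum_(k in Zs)
           cond_bernoulli_exp p k f * poisson_binomial_pmf p k)%:E
    & 'V_(gen_cond_bernoulli zeta Zs)[f \o bvec zeta]%E =
        ((\sum_(k in Zs)
            cond_bernoulli_exp p k (fun x => f x ^+ 2) *
            poisson_binomial_pmf p k) /
         (\sum_(k in Zs) poisson_binomial_pmf p k)
         - (\sum_(i < m) \sum_(j < m)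
              cond_bernoulli_exp p (z i) f * cond_bernoulli_exp p (z j) f *
              poisson_binomial_pmf p (z i) * poisson_binomial_pmf p (z j)) /
           (\sum_(k in Zs) poisson_binomial_pmf p k) ^+ 2)%:E].
Proof.
have E g := gen_cond_bernoulli_exp hp hindep hlaw g hpos.
split => [x||]; [exact: gen_cond_bernoulliE | exact: E |].
rewrite variance_fin_comp; last by move=> x; exact: measurable_bvec.
rewrite !E -EFin_expe -EFinB; congr (_%:E).
set W := \sum_(k in Zs) poisson_binomial_pmf p k.
rewrite [_ / W]mulrC exprMn [_ / W ^+ 2]mulrC exprVn; congr (_ - _ * _).
(* Injectivity of [z] lets the sum over [Zs] be indexed by ['I_m]; its square is then the double
   sum. *)
have -> : \sum_(k in Zs) cond_bernoulli_exp p k f * poisson_binomial_pmf p k =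
    \sum_i cond_bernoulli_exp p (z i) f * poisson_binomial_pmf p (z i).
  by rewrite hZs big_imset //=; exact: in2W.
rewrite expr2 big_distrlr /=.
by apply: eq_bigr => i _; apply: eq_bigr => j _; ring.
Qed.
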